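(* Let $x,y\in\mathbb{Z}_{\ge1}$ and let $b_1(i,j),b_2(i,j)\in[0,1]$ for $(i,j)\in\{1,\dots,x\}\times\{1,\dots,y\}$. Consider a two-colored CS6V model on $[1,x]\times[1,y]$ in which the vertex configurations are assigned using the matrix $\mathsf{L}^2$ and the only lines entering from the bottom and left boundaries are lines of the second color (at most one per boundary edge). Let $H^1(x,y)$ denote the height function at $(x,y)$ when only lines of the first color are considered (the lines of the $1$-fold projection), and let $H^2(x,y)$ denote the height function at $(x,y)$ of the $2$-fold projection of both colors to the single-colored model. Then, almost surely, $$H^1(x,y)\le H^2(x,y).$$
   Context: Boolean-type product. Regard $b_1,b_2$ as indeterminates and let $W'=\{0,1,b_1,b_2,1-b_1,1-b_2\}$ and $W=W'\cup\{b_1b_2,\,b_1(1-b_2),\,(1-b_1)b_2,\,(1-b_1)(1-b_2)\}$. For $w\in W$ let $[w]$ be its set of factors: $[w]=\{w\}$ if $w\in W'$, $[b_1b_2]=\{b_1,b_2\}$, and similarly for the other products of two factors. For $v,w\in W$ set $v*w=0$ if $\{b_1,1-b_1\}\subseteq[v]\cup[w]$ or $\{b_2,1-b_2\}\subseteq[v]\cup[w]$, and $v*w=\prod_{z\in[v]\cup[w]}z$ otherwise. Matrix $\mathsf{L}^1$ (indexed by $i,j,k,l\in\{0,1\}$, the numbers of lines at the bottom, left, top, right of a vertex): $\mathsf{L}^1(1,0;1,0)=1$, $\mathsf{L}^1(0,1;0,1)=1$, $\mathsf{L}^1(0,0;0,0)=b_2$, $\mathsf{L}^1(0,0;1,1)=1-b_2$,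 $\mathsf{L}^1(1,1;1,1)=b_1$, $\mathsf{L}^1(1,1;0,0)=1-b_1$, all other entries $0$. For $\mathbf{v}=(v_1,v_2)\in\{0,1\}^2$ let $\mathfrak{s}_1(\mathbf{v})=v_1$ and $\mathfrak{s}_2(\mathbf{v})=(v_1+v_2)\bmod2$. For $\mathbf{i},\mathbf{j},\mathbf{k},\mathbf{l}\in\{0,1\}^2$, $$\mathsf{L}^2(\mathbf{i},\mathbf{j};\mathbf{k},\mathbf{l})=\mathsf{L}^1(\mathfrak{s}_1(\mathbf{i}),\mathfrak{s}_1(\mathbf{j});\mathfrak{s}_1(\mathbf{k}),\mathfrak{s}_1(\mathbf{l}))*\mathsf{L}^1(\mathfrak{s}_2(\mathbf{i}),\mathfrak{s}_2(\mathbf{j});\mathfrak{s}_2(\mathbf{k}),\mathfrak{s}_2(\mathbf{l})),$$ computed formally in $W$ and then evaluated numerically. This is a stochastic matrix: for given $(\mathbf{i},\mathbf{j})$, $\mathsf{L}^2(\mathbf{i},\mathbf{j};\cdot,\cdot)$ is a probability measure. Two-colored CS6V model on $[1,x]\times[1,y]$. Vertices are the integer points of the rectangle. Each vertex has input edges (bottom, left) and output edges (top, right); the top edge of $(i,j)$ is the bottom edge of $(i,j+1)$, the right edge of $(i,j)$ is the left edge of $(i+1,j)$. Each edge carries an element of $\{0,1\}^2$ whose $c$-th coordinate is the number of lines of color $c$ on it. Given the boundary data on the left edges of column $1$ and the bottom edges of row $1$, the vertices are processed sequentially (each after its left and lower neighbours); given the bottom and left inputs $\mathbf{i},\mathbf{j}$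 at $(a,b)$, the top and right outputs $(\mathbf{k},\mathbf{l})$ are sampled, conditionally independently of the past, with probability $\mathsf{L}^2(\mathbf{i},\mathbf{j};\mathbf{k},\mathbf{l})$ with $b_1=b_1(a,b)$, $b_2=b_2(a,b)$. For $r\in\{1,2\}$ the $r$-fold projection is the single-colored configuration in which an edge carrying $\mathbf{v}$ carries $\mathfrak{s}_r(\mathbf{v})$ lines. The height function at $(x,y)$ of a single-colored configuration on the rectangle is the number of lines entering $[1,x]\times[1,y]$ through the left boundary plus the number of lines exiting it through the top boundary. *)

(* Defs.v *)
From HB Require Import structures.
From mathcomp Require Import all_boot all_order all_algebra.
From mathcomp Require Import all_classical all_reals all_analysis.
From mathcomp Require Import ring.

Set Implicit Arguments.
Unset Strict Implicit.
Unset Printing Implicit Defensive.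

Import Order.TTheory GRing.Theory Num.Theory.

Local Open Scope classical_set_scope.
Local Open Scope ring_scope.

(* The set W' = {0, 1, b1, 1 - b1, b2, 1 - b2} of formal expressions. *)
Inductive factor := Zero | One | B1 | B1c | B2 | B2c.

Definition nat_of_factor (z : factor) : nat :=
  match z with Zero => 0 | One => 1 | B1 => 2 | B1c => 3 | B2 => 4 | B2c => 5 end.

Definition factor_of_nat (n : nat) : factor :=
  match n with 0 => Zero | 1 => One | 2 => B1 | 3 => B1c | 4 => B2 | _ => B2c end.

Lemma nat_of_factorK : cancel nat_of_factor factor_of_nat.
Proof. by case. Qed.

HB.instance Definition _ := Countable.copy factor (can_type nat_of_factorK).

Lemma factor_enumP : Finite.axiom [:: Zero; One; B1; B1c; B2; B2c].
Proof. by case. Qed.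

HB.instance Definition _ := fintype.isFinite.Build factor factor_enumP.

(* The set W: the elements of W' and the four products of two of them. *)
Inductive weight :=
  Single of factor | B1_B2 | B1_B2c | B1c_B2 | B1c_B2c.

Definition factors (w : weight) : {set factor} :=
  match w with
  | Single z => [set z]%SET
  | B1_B2 => [set B1; B2]%SET
  | B1_B2c => [set B1; B2c]%SET
  | B1c_B2 => [set B1c; B2]%SET
  | B1c_B2c => [set B1c; B2c]%SET
  end.

Definition conflict (A : {set factor}) : bool :=
  ([set B1; B1c]%SET \subset A) || ([set B2; B2c]%SET \subset A).

(* The product of the elements of A, as an element of W. This is meaningful
   only when A has no conflict; see eval_formal_prod. *)
Definition formal_prod (A : {set factor}) : weight :=
  if Zero \in A then Single Zero else
  let u := if B1 \in A then B1 else if B1c \in A then B1c else One in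
  let v := if B2 \in A then B2 else if B2c \in A then B2c else One in
  match u, v with
  | One, z => Single z
  | z, One => Single z
  | B1, B2 => B1_B2
  | B1, B2c => B1_B2c
  | B1c, B2 => B1c_B2
  | B1c, B2c => B1c_B2c
  | _, _ => Single Zero
  end.

Definition star (v w : weight) : weight :=
  let A := factors v :|: factors w in
  if conflict A then Single Zero else formal_prod A.

Definition eval_factor (R : pzRingType) (b1 b2 : R) (z : factor) : R :=
  match z with
  | Zero => 0
  | One => 1
  | B1 => b1
  | B1c => 1 - b1
  | B2 => b2
  | B2c => 1 - b2
  end.

Definition eval (R : pzRingType) (b1 b2 : R) (w : weight) : R :=
  match w with
  | Single z => eval_factor b1 b2 z
  | B1_B2 => b1 * b2
  | B1_B2c => b1 * (1 - b2)
  | B1c_B2 => (1 - b1) * b2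
  | B1c_B2c => (1 - b1) * (1 - b2)
  end.

Lemma prod_factor (R : comPzRingType) (F : factor -> R) :
  \prod_z F z = F Zero * (F One * (F B1 * (F B1c * (F B2 * F B2c)))).
Proof. by rewrite /index_enum !unlock /= mulr1. Qed.

Lemma eval_formal_prod (R : comPzRingType) (b1 b2 : R) (A : {set factor}) :
  ~~ conflict A ->
  eval b1 b2 (formal_prod A) = \prod_(z in A) eval_factor b1 b2 z.
Proof.
rewrite /conflict !finset.subUset !finset.sub1set /formal_prod.
rewrite big_mkcond /= prod_factor.
case: (Zero \in A); case: (One \in A); case: (B1 \in A); case: (B1c \in A);
  case: (B2 \in A); case: (B2c \in A) => //= _; ring.
Qed.

(* Arguments: numbers of lines at the bottom, left, top, right of a vertex. *)
Definition L1 (i j k l : bool) : weight :=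
  match i, j, k, l with
  | true,  false, true,  false => Single One
  | false, true,  false, true  => Single One
  | false, false, false, false => Single B2
  | false, false, true,  true  => Single B2c
  | true,  true,  true,  true  => Single B1
  | true,  true,  false, false => Single B1c
  | _, _, _, _ => Single Zero
  end.

(* v.1 and v.2 are the numbers of lines of color 1 and of color 2. *)
Definition color := (bool * bool)%type.

Definition s1 (v : color) : bool := v.1.
Definition s2 (v : color) : bool := v.1 (+) v.2.

Definition L2 (i j k l : color) : weight :=
  star (L1 (s1 i) (s1 j) (s1 k) (s1 l)) (L1 (s2 i) (s2 j) (s2 k) (s2 l)).

Definition L2_prob (R : pzRingType) (b1 b2 : R) (i j k l : color) : R :=
  eval b1 b2 (L2 i j k l).

Lemma L2_prob_sum1 (R : comPzRingType) (b1 b2 : R) (i j : color) :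
  \sum_(kl : color * color) L2_prob b1 b2 i j kl.1 kl.2 = 1.
Proof.
rewrite -(pair_bigA _ (fun k l => L2_prob b1 b2 i j k l)) /=.
rewrite -(pair_bigA _ (fun k1 k2 => \sum_l L2_prob b1 b2 i j (k1, k2) l)) /=.
under eq_bigr => k1 _ do under eq_bigr => k2 _ do
  rewrite -(pair_bigA _ (fun l1 l2 => L2_prob b1 b2 i j (k1, k2) (l1, l2))) /=.
rewrite !big_bool /L2_prob /L2 /s1 /s2.
case: i j => [[] []] [[] []] /=;
  rewrite /star /conflict /formal_prod /= !finset.subUset !finset.sub1set !inE /=; ring.
Qed.

(* An assignment of elements of T to the edges: vedge E a b is on the bottom
   edge of the vertex (a, b), which is also the top edge of (a, b - 1), and
   hedge E a b is on its left edge, which is also the right edge of (a - 1, b).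
   Only the edges adjacent to a vertex of [1, x] x [1, y] are relevant below. *)
Record edges (T : Type) := Edges {
  vedge : nat -> nat -> T;
  hedge : nat -> nat -> T }.

Definition map_edges (T U : Type) (f : T -> U) (E : edges T) : edges U :=
  Edges (fun a b => f (vedge E a b)) (fun a b => f (hedge E a b)).

Section vertex_edges.
Context {T : Type}.
Implicit Types (E : edges T) (p : nat * nat).

Definition bottom_edge E p := vedge E p.1 p.2.
Definition left_edge E p := hedge E p.1 p.2.
Definition top_edge E p := vedge E p.1 p.2.+1.
Definition right_edge E p := hedge E p.1.+1 p.2.

Definition same_boundary (x y : nat) (c E : edges T) : Prop :=
  (forall a, (1 <= a <= x)%N -> vedge E a 1 = vedge c a 1) /\
  (forall b, (1 <= b <= y)%N -> hedge E 1 b = hedge c 1 b).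

Definition same_outputs (c E : edges T) p : Prop :=
  top_edge E p = top_edge c p /\ right_edge E p = right_edge c p.

Definition same_past (x y : nat) (s : seq (nat * nat)) (c E : edges T) : Prop :=
  same_boundary x y c E /\ (forall p, p \in s -> same_outputs c E p).

End vertex_edges.

Definition height (x y : nat) (c : edges bool) : nat :=
  (\sum_(1 <= b < y.+1) (hedge c 1 b : nat) +
   \sum_(1 <= a < x.+1) (vedge c a y.+1 : nat))%N.

Definition sampling_order (x y : nat) (s : seq (nat * nat)) : Prop :=
  [/\ perm_eq s [seq (a, b) | a <- iota 1 x, b <- iota 1 y],
      forall a b, (1 <= a < x)%N -> (1 <= b <= y)%N ->
        (index (a, b) s < index (a.+1, b) s)%N
    & forall a b, (1 <= a <= x)%N -> (1 <= b < y)%N ->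
        (index (a, b) s < index (a, b.+1) s)%N].

Section model.
Context {d : measure_display} {Omega : measurableType d} {R : realType}.
Variable P : probability Omega R.

Definition realization (E : edges {RV P >-> color}) (w : Omega) : edges color :=
  map_edges (fun X : {RV P >-> color} => X w) E.

(* The identity is the conditional law of the outputs of p_ t given the
   boundary data and the outputs of p_0, ..., p_(t - 1), multiplied by the
   probability of the conditioning event; c ranges over the possible values. *)
Definition cs6v_model (x y : nat) (b1 b2 : nat -> nat -> R)
    (E : edges {RV P >-> color}) : Prop :=
  exists2 s, sampling_order x y s &
    forall (t : nat) (c : edges color), (t < size s)%N ->
      let p := nth (0%N, 0%N) s t in
      let past := [set w | same_past x y (take t s) c (realization E w)] in
      (P (past `&` [set w | same_outputs c (realization E w) p]) =
       P past * (L2_prob (b1 p.1 p.2) (b2 p.1 p.2)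
                   (bottom_edge c p) (left_edge c p)
                   (top_edge c p) (right_edge c p))%:E)%E.

Definition only_second_color_enters (x y : nat)
    (E : edges {RV P >-> color}) : Prop :=
  {ae P, forall w,
    (forall a, (1 <= a <= x)%N -> (vedge E a 1 w).1 = false) /\
    (forall b, (1 <= b <= y)%N -> (hedge E 1 b w).1 = false)}.

Definition H1 (x y : nat) (E : edges {RV P >-> color}) (w : Omega) : nat :=
  height x y (map_edges s1 (realization E w)).

Definition H2 (x y : nat) (E : edges {RV P >-> color}) (w : Omega) : nat :=
  height x y (map_edges s2 (realization E w)).

End model.

(* Main.v *)
Require Import Defs.
From HB Require Import structures.
From mathcomp Require Import all_boot all_order all_algebra.
From mathcomp Require Import all_classical all_reals all_analysis.
From mathcomp Require Import zify.

(** Write s = (s1, s2) for the pair of projected occupation numbers of an edge,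
and call it exceptional if it is a vertical edge with s = (1, 0) or a
horizontal edge with s = (0, 1). In the picture obtained by exchanging lines
and holes on horizontal edges, each projection becomes a six-vertex model that
conserves its paths, and an exceptional edge is one that carries a path of the
first model but none of the second. The heart of the proof is that a vertex
never creates such edges: if the formal weight L2 is nonzero, at most as many
exceptional edges leave the vertex as enter it ([exceptional_outputs_le]). If
both projections obey L1, a vertex can create one only when it receives equal
inputs in the two projections and gives different outputs, and this is precisely
what the conflicts b_i versus 1 - b_i in the product of W rule out.

Summing over the rectangle, the number of exceptional edges on the top
boundary is at most the number on the bottom and left boundaries. When only the
second color enters, no bottom edge is exceptional, while the left edges with
s = (0, 1) are all those carrying a line; their number is the contribution of
the left boundary to H2 - H1. The top boundary contributes the sum of s2 - s1,
which is at least minus its number of exceptional edges. Hence H1 <= H2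
([height_s1_le_s2]).

It remains to see that almost surely every vertex has a nonzero formal weight.
There are finitely many configurations of the edges of the rectangle, and the
sampling rule gives probability zero to the event that the past and the outputs
at a vertex follow a configuration whose weight there vanishes. *)

Set Implicit Arguments.
Unset Strict Implicit.
Unset Printing Implicit Defensive.

Import Order.TTheory GRing.Theory Num.Theory.

Local Open Scope classical_set_scope.
Local Open Scope ring_scope.

(** * Exceptional edges *)

Definition exceptional_v (v : color) : bool := s1 v && ~~ s2 v.
Definition exceptional_h (v : color) : bool := ~~ s1 v && s2 v.

(** When both entries of L1 are nonzero, a violation of the inequality forces
equal inputs and different outputs in the two projections. Both entries are then
complementary factors, so that their product has a conflict. *)
Lemma exceptional_outputs_le (i j k l : color) :
  L2 i j k l <> Single Zero ->
  (exceptional_v k + exceptional_h l <= exceptional_v i + exceptional_h j)%N.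
Proof.
rewrite /L2 /star /conflict /formal_prod /exceptional_v /exceptional_h /s1 /s2.
case: i j k l => [[] []] [[] []] [[] []] [[] []] //=;
  by rewrite ?finset.subUset ?finset.sub1set !inE.
Qed.

Definition allowed_vertex (c : edges color) (p : nat * nat) : Prop :=
  L2 (bottom_edge c p) (left_edge c p) (top_edge c p) (right_edge c p)
    <> Single Zero.

(** The horizontal edges inside the row cancel, being the output of one vertex
and the input of the next. *)
Lemma row_exceptional_le (x b : nat) (c : edges color) :
  (forall a, (1 <= a <= x)%N -> allowed_vertex c (a, b)) ->
  (\sum_(1 <= a < x.+1) exceptional_v (vedge c a b.+1) +
     exceptional_h (hedge c x.+1 b) <=
   \sum_(1 <= a < x.+1) exceptional_v (vedge c a b) +
     exceptional_h (hedge c 1 b))%N.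
Proof.
elim: x => [|x IHx] ok; first by rewrite !big_geq.
have {}IHx := IHx (fun a ha => ok a ltac:(lia)).
have /exceptional_outputs_le := ok x.+1 ltac:(lia).
by rewrite !(big_nat_recr x.+1) //= /bottom_edge /left_edge /top_edge /right_edge /=; lia.
Qed.

Lemma sum_exceptional_le (x y : nat) (c : edges color) :
  (forall a b, (1 <= a <= x)%N -> (1 <= b <= y)%N -> allowed_vertex c (a, b)) ->
  (\sum_(1 <= a < x.+1) exceptional_v (vedge c a y.+1) <=
   \sum_(1 <= a < x.+1) exceptional_v (vedge c a 1) +
   \sum_(1 <= b < y.+1) exceptional_h (hedge c 1 b))%N.
Proof.
elim: y => [|y IHy] ok; first by rewrite leq_addr.
have {}IHy := IHy (fun a b ha hb => ok a b ha ltac:(lia)).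
have := row_exceptional_le (fun a ha => ok a y.+1 ha ltac:(lia)).
by rewrite [X in (_ -> _ <= _ + X)%N]big_nat_recr //=; lia.
Qed.

Lemma height_s1_le_s2 (x y : nat) (c : edges color) :
  (forall a, (1 <= a <= x)%N -> s1 (vedge c a 1) = false) ->
  (forall b, (1 <= b <= y)%N -> s1 (hedge c 1 b) = false) ->
  (forall a b, (1 <= a <= x)%N -> (1 <= b <= y)%N -> allowed_vertex c (a, b)) ->
  (height x y (map_edges s1 c) <= height x y (map_edges s2 c))%N.
Proof.
move=> bottom left /sum_exceptional_le; rewrite /height /map_edges /=.
have -> : (\sum_(1 <= a < x.+1) exceptional_v (vedge c a 1) = 0)%N.
  rewrite big_nat_cond big1 // => a ha; rewrite /exceptional_v bottom //; lia.
have -> : (\sum_(1 <= b < y.+1) s1 (hedge c 1 b) = 0)%N.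
  rewrite big_nat_cond big1 // => b hb; rewrite left //; lia.
have -> : (\sum_(1 <= b < y.+1) exceptional_h (hedge c 1 b) =
           \sum_(1 <= b < y.+1) s2 (hedge c 1 b))%N.
  by apply: eq_big_nat => b hb; rewrite /exceptional_h left //; lia.
rewrite !add0n.
(* Exchange the left term of H2 for the top exceptional edges; what remains is
   s1 <= [exceptional] + s2 on each top edge. *)
move=> top_le; apply: leq_trans (leq_add top_le (leqnn _)).
rewrite -big_split; apply: leq_sum => a _; rewrite /exceptional_v /=.
by case: s1; case: s2.
Qed.

(** * Forbidden vertices have probability zero *)

Section measurability.
Context {d : measure_display} {T : measurableType d}.

Lemma measurable_forall (I : countType) (A : I -> set T) :
  (forall i, measurable (A i)) -> measurable [set w | forall i, A i w].
Proof.
move=> mA.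
rewrite (_ : mkset _ = \bigcap_n (if unpickle n is Some i then A i else setT)).
  by apply: bigcapT_measurable => n; case: unpickle => [i|].
apply/seteqP; split => w /= Aw => [n _|i]; first by case: unpickle => [i|]//.
by have := Aw (pickle i) Logic.I; rewrite pickleK.
Qed.

Lemma measurable_implies (Q : Prop) (A : set T) :
  measurable A -> measurable [set w | Q -> A w].
Proof.
move=> mA; have [q|nq] := pselect Q.
  by rewrite (_ : mkset _ = A)//; apply/seteqP; split => w /= => [/(_ q)|].
by rewrite (_ : mkset _ = setT)//; apply/seteqP; split => w //= _ /nq.
Qed.

Context {R : realType} {P : probability T R}.

Lemma measurable_rv_eq (X : {RV P >-> color}) (v : color) :
  measurable [set w | X w = v].
Proof.
have -> : [set w | X w = v] = X @^-1` ([set v.1] `*` [set v.2]).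
  by apply/seteqP; split => w /=; [move=> -> | case: (X w) v => ? ? [? ?] [/= -> ->]].
by apply: measurable_funPTI; exact: measurableX.
Qed.

(** The conditioning events must be shown measurable: negligibility asks for a
measurable null set. *)
Lemma measurable_same_outputs (E : edges {RV P >-> color}) c p :
  measurable [set w | same_outputs c (realization E w) p].
Proof. by apply: measurableI; exact: measurable_rv_eq. Qed.

Lemma measurable_same_past x y s (E : edges {RV P >-> color}) c :
  measurable [set w | same_past x y s c (realization E w)].
Proof.
apply: measurableI; first apply: measurableI.
- by apply: measurable_forall => a; apply: measurable_implies;
    exact: measurable_rv_eq.
- by apply: measurable_forall => b; apply: measurable_implies;
    exact: measurable_rv_eq.
- by apply: measurable_forall => p; apply: measurable_implies;
    exact: measurable_same_outputs.
Qed.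

End measurability.

(** A union over all elements of [edges color] would be uncountable, hence this
finite type of configurations. The indices reach x + 1 and y + 1, because the
right and top boundary edges are stored there. *)
Definition rectangle_edges (x y : nat) :=
  ({ffun 'I_x.+2 * 'I_y.+2 -> color} * {ffun 'I_x.+2 * 'I_y.+2 -> color})%type.

Definition edges_of (x y : nat) (c : rectangle_edges x y) : edges color :=
  Edges (fun a b => c.1 (inord a, inord b)) (fun a b => c.2 (inord a, inord b)).

Definition restrict (x y : nat) (c : edges color) : rectangle_edges x y :=
  ([ffun p => vedge c (p.1 : 'I__) (p.2 : 'I__)],
   [ffun p => hedge c (p.1 : 'I__) (p.2 : 'I__)]).

Lemma vedge_restrict (x y : nat) (c : edges color) a b :
  (a <= x.+1)%N -> (b <= y.+1)%N ->
  vedge (edges_of (restrict x y c)) a b = vedge c a b.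
Proof. by move=> ha hb; rewrite /= ffunE /= !inordK. Qed.

Lemma hedge_restrict (x y : nat) (c : edges color) a b :
  (a <= x.+1)%N -> (b <= y.+1)%N ->
  hedge (edges_of (restrict x y c)) a b = hedge c a b.
Proof. by move=> ha hb; rewrite /= ffunE /= !inordK. Qed.

(** If a sample point has a forbidden vertex, so does its restriction to the
rectangle, and the sample point follows that restriction. Hence the bad event is
covered by finitely many null events, one for each configuration that is
forbidden at this vertex. *)
Lemma ae_allowed_vertex (d : measure_display) (Omega : measurableType d)
    (R : realType) (P : probability Omega R) (x y : nat) (b1 b2 : nat -> nat -> R)
    (E : edges {RV P >-> color}) (a b : nat) :
  cs6v_model x y b1 b2 E -> (1 <= a <= x)%N -> (1 <= b <= y)%N ->
  {ae P, forall w, allowed_vertex (realization E w) (a, b)}.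
Proof.
move=> [s [/perm_mem s_mem _ _] law] ha hb.
have in_s p : p \in s -> (1 <= p.1 <= x)%N /\ (1 <= p.2 <= y)%N.
  by rewrite s_mem => /allpairsP[q [+ + ->]]; rewrite !mem_iota /=; lia.
have ab_s : (a, b) \in s.
  by rewrite s_mem; apply/allpairsP; exists (a, b); rewrite !mem_iota /=; split=> //; lia.
set t := index (a, b) s; have t_lt : (t < size s)%N by rewrite index_mem.
pose follows c := [set w | same_past x y (take t s) c (realization E w)] `&`
                  [set w | same_outputs c (realization E w) (a, b)].
have null c : L2 (bottom_edge c (a, b)) (left_edge c (a, b))
    (top_edge c (a, b)) (right_edge c (a, b)) = Single Zero -> P (follows c) = 0%E.
  move=> forbidden; have := law t c t_lt; rewrite nth_index //= => ->.
  by rewrite /L2_prob forbidden mule0.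
have ae_code (c : rectangle_edges x y) :
    {ae P, forall w, follows (edges_of c) w -> allowed_vertex (edges_of c) (a, b)}.
  exists (if pselect (allowed_vertex (edges_of c) (a, b)) then set0
          else follows (edges_of c)).
  case: pselect => [ok|not_ok] /=.
    by split=> // w /= [].
  have forbidden := contrapT not_ok; split; last 1 first.
  - by move=> w /= bad; apply: contrapT => nf; apply: bad => /nf.
  - by apply: measurableI; [exact: measurable_same_past|exact: measurable_same_outputs].
  - exact: null.
have ae_all : {ae P, forall w (c : rectangle_edges x y),
    follows (edges_of c) w -> allowed_vertex (edges_of c) (a, b)}.
  exact: filter_forall.
apply: filterS ae_all => w /(_ (restrict x y (realization E w))).
have outputs p : (1 <= p.1 <= x)%N /\ (1 <= p.2 <= y)%N ->
    same_outputs (edges_of (restrict x y (realization E w))) (realization E w) p.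
  by move=> hp; rewrite /same_outputs /top_edge /right_edge
    vedge_restrict ?hedge_restrict //; lia.
rewrite /allowed_vertex /bottom_edge /left_edge /top_edge /right_edge.
rewrite !vedge_restrict ?hedge_restrict /=; try lia.
apply; split; last by apply: outputs.
split; last by move=> p /mem_take /in_s /outputs.
by split=> [a' ha'|b' hb']; rewrite ?vedge_restrict ?hedge_restrict //; lia.
Qed.

Theorem proposition2p7 (R : realType) (d : measure_display)
    (Omega : measurableType d) (P : probability Omega R)
    (x y : nat) (b1 b2 : nat -> nat -> R)
    (E : edges {RV P >-> color})
    (hx : (1 <= x)%N) (hy : (1 <= y)%N)
    (hb1 : forall i j, (1 <= i <= x)%N -> (1 <= j <= y)%N -> 0 <= b1 i j <= 1)
    (hb2 : forall i j, (1 <= i <= x)%N -> (1 <= j <= y)%N -> 0 <= b2 i j <= 1)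
    (hmodel : cs6v_model x y b1 b2 E)
    (hboundary : only_second_color_enters x y E) :
  {ae P, forall w, (H1 x y E w <= H2 x y E w)%N}.
Proof.
(* Quantifying over a finite type turns the almost sure statements for each
   vertex into one for all vertices at once. *)
have ae_ok : {ae P, forall w, forall p : 'I_x.+1 * 'I_y.+1,
    (1 <= p.1)%N -> (1 <= p.2)%N ->
    allowed_vertex (realization E w) (val p.1, val p.2)}.
  apply: filter_forall => -[a b] /=.
  have [ha|ha] := boolP (1 <= a)%N; last by apply: aeW.
  have [hb|hb] := boolP (1 <= b)%N; last by apply: aeW.
  have a_le := ltn_ord a; have b_le := ltn_ord b.
  by apply: filterS (ae_allowed_vertex (a := a) (b := b) hmodel _ _) => //; lia.
apply: filterS2 hboundary ae_ok => w [bottom left] ok.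
apply: height_s1_le_s2 => //= a b /andP[a_ge a_le] /andP[b_ge b_le].
by have := ok (Ordinal (a_le : (a < x.+1)%N), Ordinal (b_le : (b < y.+1)%N)); exact.
Qed.
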